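(* Every strongly regular graph with at least six vertices is $2$-reconstructible; that is, if $G$ is a strongly regular graph with $n\ge 6$ vertices, then every graph $H$ with $n$ vertices having the same $(n-2)$-deck as $G$ is isomorphic to $G$.
   Context: All graphs are finite, simple (no loops or multiple edges). For an $n$-vertex graph $G$ and $1\le k\le n$, the $k$-deck of $G$ is the multiset of isomorphism classes of the $\binom{n}{k}$ induced subgraphs of $G$ on $k$ vertices (one for each $k$-subset of $V(G)$). A graph is $\ell$-reconstructible if it is determined up to isomorphism by its $(n-\ell)$-deck, i.e., every $n$-vertex graph with the same $(n-\ell)$-deck is isomorphic to it. A graph is strongly regular with parameters $(k,\lambda,\mu)$ if it is $k$-regular, every two adjacent vertices have exactly $\lambda$ common neighbors, and every two distinct nonadjacent vertices have exactly $\mu$ common neighbors. *)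

(* Defs.v *)
From mathcomp Require Import all_boot.

Set Implicit Arguments.
Unset Strict Implicit.
Unset Printing Implicit Defensive.

Record sgraph := SGraph {
  vertex :> finType;
  adj : rel vertex;
  adj_sym : symmetric adj;
  adj_irrefl : irreflexive adj
}.

Definition isomorphic (G H : sgraph) : Prop :=
  exists2 f : G -> H, bijective f & forall x y : G, adj (f x) (f y) = adj x y.

(* Boolean version of [isomorphic], needed to count induced subgraphs;
   see [isomorphicP]. *)
Definition isob (G H : sgraph) : bool :=
  [exists f : {ffun G -> H},
    [&& [forall y, exists x, f x == y], injectiveb f &
        [forall x, forall y, adj (f x) (f y) == adj x y]]].

Lemma isomorphicP (G H : sgraph) : reflect (isomorphic G H) (isob G H).
Proof.
apply: (iffP existsP) => [[f /and3P[/forallP sf /injectiveP jf /'forall_'forall_eqP ef]]|].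
- exists f => //; pose g y := xchoose (existsP (sf y)).
  have gK : cancel g f by move=> y; apply/eqP/(xchooseP (existsP (sf y))).
  by exists g => // x; apply: jf; rewrite gK.
- case=> f [g fK gK] ef; exists [ffun x => f x]; apply/and3P; split.
  + by apply/forallP => y; apply/existsP; exists (g y); rewrite ffunE gK.
  + by apply/injectiveP => x y; rewrite !ffunE => /(can_inj fK).
  + by apply/'forall_'forall_eqP => x y; rewrite !ffunE ef.
Qed.

Section Induced.
Variables (G : sgraph) (A : {set G}).

Definition induced_adj : rel {x : G | x \in A} :=
  fun x y => adj (val x) (val y).

Lemma induced_adj_sym : symmetric induced_adj.
Proof. by move=> x y; apply: adj_sym. Qed.

Lemma induced_adj_irrefl : irreflexive induced_adj.
Proof. by move=> x; apply: adj_irrefl. Qed.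

Definition induced : sgraph := SGraph induced_adj_sym induced_adj_irrefl.
End Induced.

(* The multiplicity, in the k-deck of G, of the isomorphism class of F. *)
Definition deck_mult (k : nat) (G F : sgraph) : nat :=
  #|[set A : {set G} | (#|A| == k) && isob (induced A) F]|.

(* Equality of the k-decks as multisets of isomorphism classes: every class,
   given by a representative F, has the same multiplicity in both. *)
Definition same_deck (k : nat) (G H : sgraph) : Prop :=
  forall F : sgraph, deck_mult k G F = deck_mult k H F.

(* For use with l < #|G|, as the subtraction is truncated. *)
Definition reconstructible (l : nat) (G : sgraph) : Prop :=
  forall H : sgraph, #|H| = #|G| -> same_deck (#|G| - l) G H -> isomorphic H G.

Definition common_nbrs (G : sgraph) (x y : G) : {set G} :=
  [set z | adj x z && adj y z].

(* No degenerate case is excluded: complete and edgeless graphs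
   qualify, the condition on mu (resp. lambda) being vacuous for them. *)
Definition strongly_regular (G : sgraph) (k lambda mu : nat) : Prop :=
  [/\ forall x : G, #|[set y | adj x y]| = k,
      forall x y : G, adj x y -> #|common_nbrs x y| = lambda
    & forall x y : G, x != y -> ~~ adj x y -> #|common_nbrs x y| = mu].

(* Main.v *)
(** Averaging over the cards recovers the number of edges and of paths with two
    edges, hence the first two moments of the degrees; as G is regular, the
    degrees of H have variance zero and H is regular of the same degree.  A card
    of H obtained by deleting u and v is a card of G, so H and G can be drawn on
    one vertex set so that they differ only at edges meeting {u, v}.  Comparing
    degrees then shows that u and v are adjacent in both or in neither and have
    as many common neighbours in both, so H is strongly regular with the
    parameters of G.  Finally, comparing the numbers of common neighbours of two
    other vertices determines, up to exchanging u and v, which of them each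
    remaining vertex is adjacent to, and the isomorphism of cards extends. *)
Require Import Defs.
From mathcomp Require Import all_boot zify.

Set Implicit Arguments.
Unset Strict Implicit.
Unset Printing Implicit Defensive.

(** * Isomorphism as an equivalence relation *)

Lemma isomorphic_refl (G : sgraph) : isomorphic G G.
Proof. by exists id => //; exists id. Qed.

Lemma isomorphic_sym (G H : sgraph) : isomorphic G H -> isomorphic H G.
Proof.
case=> f [g fK gK] fE; exists g; first by exists f.
by move=> x y; rewrite -fE !gK.
Qed.

Lemma isomorphic_trans (G H K : sgraph) :
  isomorphic G H -> isomorphic H K -> isomorphic G K.
Proof.
case=> f fB fE [g gB gE]; exists (g \o f); first exact: bij_comp.
by move=> x y /=; rewrite gE fE.
Qed.

Lemma isob_congr (F G H : sgraph) :
  isomorphic G H -> isob F G = isob F H.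
Proof.
move=> GH; apply/isomorphicP/isomorphicP => FG; first exact: isomorphic_trans GH.
exact/(isomorphic_trans FG)/isomorphic_sym.
Qed.

(** * Sums of an invariant over a deck *)

Section DeckSum.
Variables (m : nat) (G : sgraph) (phi : sgraph -> nat).
Hypothesis phi_iso : forall F F' : sgraph, isomorphic F F' -> phi F = phi F'.

(* The pick depends only on the isomorphism class of F, so it selects one
   canonical card of G in that class. *)
Definition card_repr (F : sgraph) : option {set G} :=
  [pick A : {set G} | (#|A| == m) && isob (induced A) F].

Lemma card_repr_congr (F F' : sgraph) :
  isomorphic F F' -> card_repr F = card_repr F'.
Proof. by move=> FF'; apply: eq_pick => A; rewrite (isob_congr _ FF'). Qed.

(** Cards of [K] are grouped by their representatives in [G]. The right side does not involve [K],
    so it equates the sums for any two such graphs. *)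
Lemma deck_sumE (K : sgraph) : same_deck m G K ->
  \sum_(B : {set K} | #|B| == m) phi (induced B) =
  \sum_(A : {set G} | (#|A| == m) && (card_repr (induced A) == Some A))
     deck_mult m G (induced A) * phi (induced A).
Proof.
move=> GK.
have reprP (B : {set K}) : #|B| == m -> exists A : {set G},
    [/\ #|A| == m, isomorphic (induced A) (induced B) &
        card_repr (induced B) = Some A].
  move=> Bm; rewrite /card_repr; case: pickP => [A /andP[Am /isomorphicP AB]|no].
    by exists A.
  have : 0 < deck_mult m G (induced B).
    rewrite GK; apply/card_gt0P; exists B; rewrite inE Bm.
    exact/isomorphicP/isomorphic_refl.
  by case/card_gt0P => A; rewrite inE no.
rewrite (partition_big (fun B => odflt set0 (card_repr (induced B)))
   (fun A => (#|A| == m) && (card_repr (induced A) == Some A))) /=; last first.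
  move=> B /reprP[A [Am AB cB]].
  by rewrite cB /= Am (card_repr_congr AB) cB eqxx.
apply: eq_bigr => A /andP[Am /eqP cA].
rewrite GK /deck_mult -sum_nat_const; apply: eq_big => [B | B /andP[Bm]].
  rewrite inE; case Bm: (#|B| == m) => //=.
  have [A' [A'm A'B cB]] := reprP B Bm; rewrite cB /=.
  apply/eqP/isomorphicP => [<- | BA]; first exact: isomorphic_sym.
  by move: cB; rewrite (card_repr_congr BA) cA => -[].
have [A' [_ A'B ->]] := reprP B Bm; move=> /= /eqP <-.
by apply/phi_iso/isomorphic_sym.
Qed.

Lemma same_deck_sum (H : sgraph) : same_deck m G H ->
  \sum_(A : {set G} | #|A| == m) phi (induced A) =
  \sum_(B : {set H} | #|B| == m) phi (induced B).
Proof. by move=> GH; rewrite (deck_sumE GH) deck_sumE. Qed.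

End DeckSum.

(** * Counting edges and two-edge paths from the deck *)

Lemma sum_supersets_codim2 (T : finType) (S : {set T}) : 2 <= #|T| ->
  \sum_(A : {set T} | #|A| == #|T| - 2) (S \subset A : nat) = 'C(#|T| - #|S|, 2).
Proof.
move=> T2; have -> : #|T| - #|S| = #|~: S| by rewrite [RHS]cardsCs setCK.
(* Complements turn the supersets of [S] that miss two elements into the pairs outside [S]. *)
rewrite -cards_draws -sum1dep_card (reindex_inj (@setC_inj T)) /= -big_mkcondr /=.
apply: eq_bigl => A; rewrite -(setCS _ S) setCK andbC; congr (_ && _).
move: (cardsC A) T2; move: #|~: A| #|A| => b a <- ?; by apply/eqP/eqP; lia.
Qed.

(** Twice the number of edges. *)
Definition arcs (F : sgraph) : nat := \sum_(x : F) \sum_(y : F) adj x y.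

(** Twice the number of paths with two edges, [x] being the centre. *)
Definition cherries (F : sgraph) : nat :=
  \sum_(x : F) \sum_(y : F) \sum_(z : F) [&& z != y, adj x y & adj x z].

Lemma arcs_iso (F F' : sgraph) : isomorphic F F' -> arcs F = arcs F'.
Proof.
case=> f fB fE; rewrite /arcs (reindex f) /=; last exact: onW_bij.
apply: eq_bigr => x _; rewrite (reindex f) /=; last exact: onW_bij.
by apply: eq_bigr => y _; rewrite fE.
Qed.

Lemma cherries_iso (F F' : sgraph) : isomorphic F F' -> cherries F = cherries F'.
Proof.
case=> f fB fE; rewrite /cherries (reindex f) /=; last exact: onW_bij.
apply: eq_bigr => x _; rewrite (reindex f) /=; last exact: onW_bij.
apply: eq_bigr => y _; rewrite (reindex f) /=; last exact: onW_bij.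
by apply: eq_bigr => z _; rewrite !fE (inj_eq (bij_inj fB)).
Qed.

Lemma big_induced (G : sgraph) (A : {set G}) (F : G -> nat) :
  \sum_(x : induced A) F (val x) = \sum_(x : G) (x \in A) * F x.
Proof.
rewrite -(@big_sub _ _ _ _ (mem A)) big_mkcond.
by apply: eq_bigr => x _; rewrite mulnbl.
Qed.

(** Double counting: an arc survives in exactly the cards that keep both its ends. *)
Lemma deck_sum_arcs (G : sgraph) : 2 <= #|G| ->
  \sum_(A : {set G} | #|A| == #|G| - 2) arcs (induced A)
    = arcs G * 'C(#|G| - 2, 2).
Proof.
move=> G2.
transitivity (\sum_(A : {set G} | #|A| == #|G| - 2)
   \sum_(x : G) \sum_(y : G) adj x y * ([set x; y] \subset A)).
  apply: eq_bigr => A _; rewrite /arcs.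
  rewrite (big_induced A (fun x => \sum_(y : induced A) adj x (val y))).
  apply: eq_bigr => x _; rewrite (big_induced A (fun y => adj x y)) big_distrr /=.
  apply: eq_bigr => y _; rewrite subUset !sub1set.
  by case: (adj x y); case: (x \in A); case: (y \in A).
rewrite exchange_big big_distrl; apply: eq_bigr => x _.
rewrite exchange_big big_distrl; apply: eq_bigr => y _ /=.
rewrite -big_distrr /= sum_supersets_codim2 //.
case xy: (adj x y) => //; rewrite cards2.
by case: eqP xy => // ->; rewrite adj_irrefl.
Qed.

Lemma deck_sum_cherries (G : sgraph) : 2 <= #|G| ->
  \sum_(A : {set G} | #|A| == #|G| - 2) cherries (induced A)
    = cherries G * 'C(#|G| - 3, 2).
Proof.
move=> G2.
transitivity (\sum_(A : {set G} | #|A| == #|G| - 2)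
   \sum_(x : G) \sum_(y : G) \sum_(z : G)
     [&& z != y, adj x y & adj x z] * ([set x; y; z] \subset A)).
  apply: eq_bigr => A _; rewrite /cherries.
  rewrite (big_induced A (fun x => \sum_(y : induced A) \sum_(z : induced A)
     [&& z != y, adj x (val y) & adj x (val z)])).
  apply: eq_bigr => x _.
  rewrite (big_induced A (fun y => \sum_(z : induced A)
     [&& val z != y, adj x y & adj x (val z)])) big_distrr /=.
  apply: eq_bigr => y _.
  rewrite (big_induced A (fun z => [&& z != y, adj x y & adj x z])) !big_distrr /=.
  apply: eq_bigr => z _; rewrite !subUset !sub1set.
  by case: [&& _, _ & _]; case: (x \in A); case: (y \in A); case: (z \in A).
rewrite exchange_big big_distrl; apply: eq_bigr => x _.
rewrite exchange_big big_distrl; apply: eq_bigr => y _ /=.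
rewrite exchange_big big_distrl; apply: eq_bigr => z _ /=.
rewrite -big_distrr /= sum_supersets_codim2 //.
case: and3P => // -[zy xy xz]; rewrite setUC cardsU1 cards2 !inE (negPf zy) orbF.
have nadj w : adj x w -> x != w by apply: contraTneq => ->; rewrite adj_irrefl.
by rewrite (eq_sym z) !nadj.
Qed.

(** * Degree moments and regularity *)

Lemma card_set_sum (T : finType) (P : pred T) :
  #|[set y | P y]| = \sum_y (P y : nat).
Proof. by rewrite -sum1dep_card big_mkcond. Qed.

Lemma arcs_degrees (G : sgraph) : arcs G = \sum_(x : G) #|[set y | adj x y]|.
Proof. by apply: eq_bigr => x _; rewrite card_set_sum. Qed.

(** A squared degree counts ordered pairs of neighbours; the pairs with equal entries give the
    arcs. *)
Lemma cherries_degrees (G : sgraph) :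
  cherries G + arcs G = \sum_(x : G) #|[set y | adj x y]| ^ 2.
Proof.
rewrite -big_split /=; apply: eq_bigr => x _.
rewrite card_set_sum expnS expn1 big_distrl -big_split /=; apply: eq_bigr => y _.
rewrite big_distrr /= [RHS](bigD1 y) //= (bigD1 y) //= eqxx add0n addnC.
congr (_ + _); first by case: (adj x y).
by apply: eq_bigr => z ->; case: (adj x y); case: (adj x z).
Qed.

(* Equal arc and cherry counts mean equal first and second moments of the
   degrees, so the degrees of H have variance zero. *)
Lemma same_deck_regular (G H : sgraph) (k : nat) :
  5 <= #|G| -> #|H| = #|G| -> same_deck (#|G| - 2) G H ->
  (forall x : G, #|[set y | adj x y]| = k) ->
  forall u : H, #|[set v | adj u v]| = k.
Proof.
move=> G5 HG deck reg.
have G2 : 2 <= #|G| by lia.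
have arcsE : arcs H = #|G| * k.
  have := same_deck_sum arcs_iso deck.
  rewrite deck_sum_arcs // -HG deck_sum_arcs ?HG // => /eqP.
  rewrite eqn_pmul2r ?bin_gt0; last lia.
  move=> /eqP <-; rewrite arcs_degrees (eq_bigr (fun=> k)) ?sum_nat_const //.
have cherriesE : cherries H + arcs H = #|G| * k ^ 2.
  have := same_deck_sum cherries_iso deck.
  rewrite deck_sum_cherries // -HG deck_sum_cherries ?HG // => /eqP.
  (* The factor ['C(#|G| - 3, 2)] is positive because [5 <= #|G|]. *)
  rewrite eqn_pmul2r ?bin_gt0; last lia.
  move=> /eqP <-; have -> : arcs H = arcs G.
    by rewrite arcsE arcs_degrees (eq_bigr (fun=> k)) ?sum_nat_const.
  rewrite cherries_degrees (eq_bigr (fun=> k ^ 2)) ?sum_nat_const // => x _.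
  by rewrite reg.
pose d (u : H) := #|[set v | adj u v]|.
(* 2dk <= d^2 + k^2, with equality only at d = k. Summed over the n vertices of [H], both sides are
   2nk^2, so equality holds at each vertex. *)
have [_] := @leqif_sum H xpredT (fun u => d u == k) _ _ (fun u _ => nat_Cauchy (d u) k).
rewrite -big_distrr -big_distrl /= -arcs_degrees big_split /= -cherries_degrees.
rewrite sum_nat_const cherriesE arcsE HG.
have -> : 2 * (#|G| * k * k) == #|G| * k ^ 2 + #|G| * k ^ 2 by apply/eqP; nia.
by move=> /esym/forallP eqd u; apply/eqP/eqd.
Qed.

(** * Two graphs that agree off one pair of vertices *)

Section AgreeOffPair.
Variables (T : finType) (e e' : rel T) (u v : T).
Hypotheses (e_sym : symmetric e) (e'_sym : symmetric e').
Hypotheses (e_irr : irreflexive e) (e'_irr : irreflexive e').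
Hypothesis uv : u != v.

Let off w := (w != u) && (w != v).

Hypothesis agree : forall a b, off a -> off b -> e' a b = e a b.

Let sum_off (F : T -> nat) : \sum_b F b = F u + F v + \sum_(b | off b) F b.
Proof. by rewrite (bigD1 u) //= (bigD1 v) 1?eq_sym //= addnA. Qed.

(** Entries off the pair are common to both rows and cancel. *)
Lemma pair_row_sum w : off w -> \sum_b (e w b : nat) = \sum_b (e' w b : nat) ->
  e w u + e w v = e' w u + e' w v.
Proof.
move=> ow; rewrite !sum_off.
rewrite [in RHS](eq_bigr (fun b => nat_of_bool (e w b))) => [|b ob].
  by move/addIn.
by rewrite agree.
Qed.

Lemma pair_gram w z : off w -> off z ->
  \sum_b (e w b && e z b : nat) = \sum_b (e' w b && e' z b : nat) ->
  (e w u && e z u) + (e w v && e z v) = (e' w u && e' z u) + (e' w v && e' z v).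
Proof.
move=> ow oz; rewrite !sum_off.
rewrite [in RHS](eq_bigr (fun b => nat_of_bool (e w b && e z b))) => [|b ob].
  by move/addIn.
by rewrite !agree.
Qed.

Hypothesis deg_eq : forall w, \sum_b (e w b : nat) = \sum_b (e' w b : nat).

Let row_sum w (ow : off w) := pair_row_sum ow (deg_eq w).

(** In the sum of the degrees of [u] and [v], vertices off the pair contribute equally by [row_sum];
    what remains is twice [e u v]. *)
Lemma pair_edge : e u v = e' u v.
Proof.
have : \sum_b (e u b + e v b) = \sum_b (e' u b + e' v b).
  by rewrite !big_split /= !deg_eq.
rewrite !sum_off !e_irr !e'_irr (e_sym v) (e'_sym v).
rewrite [in RHS](eq_bigr (fun b => e u b + e v b)) => [|b ob].
  by move/addIn; case: (e u v); case: (e' u v).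
by rewrite ![e' _ b]e'_sym ![e _ b]e_sym row_sum.
Qed.

(** A vertex off the pair is a common neighbour exactly when its two entries sum to 2, and [row_sum]
    equates these sums. *)
Lemma pair_codegree :
  \sum_b (e u b && e v b : nat) = \sum_b (e' u b && e' v b : nat).
Proof.
rewrite !sum_off !e_irr !e'_irr !andbF; congr (_ + _); apply: eq_bigr => b ob.
have := row_sum ob; rewrite ![e' b _]e'_sym ![e b _]e_sym.
by case: (e u b); case: (e v b); case: (e' u b); case: (e' v b).
Qed.

Hypothesis codeg_eq : forall w z, off w -> off z -> w != z ->
  \sum_b (e w b && e z b : nat) = \sum_b (e' w b && e' z b : nat).

(* The rows (e w u, e w v), for w off the pair, have the same Gram matrix as
   the rows of e', and 0/1 vectors of length 2 are determined by their Gram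
   matrix up to exchanging the two coordinates. *)
Lemma pair_rows :
  (forall w, off w -> e' w u = e w u /\ e' w v = e w v) \/
  (forall w, off w -> e' w u = e w v /\ e' w v = e w u).
Proof.
have gram w z : off w -> off z ->
    (e w u && e z u) + (e w v && e z v)
      = (e' w u && e' z u) + (e' w v && e' z v).
  move=> ow oz; have [-> | wz] := eqVneq w z; first by rewrite !andbb row_sum.
  exact/pair_gram/codeg_eq.
(* A row with unequal entries shows whether [u] and [v] are exchanged, and its product with any
   other row fixes that row. Without one, each row is determined by its sum. *)
case: (pickP (fun w => off w && (e w u != e w v))) => [w0 /andP[o0 ne0] | eq_row].
  case eq0: (e' w0 u == e w0 u); [left | right] => w ow;
    move: (row_sum o0) (row_sum ow) (gram _ _ o0 ow) ne0 eq0;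
    case: (e w0 u); case: (e w0 v); case: (e' w0 u); case: (e' w0 v) => //;
    by case: (e w u); case: (e w v); case: (e' w u); case: (e' w v).
left=> w ow; move: (row_sum ow) (eq_row w); rewrite ow.
by case: (e w u); case: (e w v); case: (e' w u); case: (e' w v).
Qed.

(** By [pair_rows], the identity or the exchange of [u] and [v] works; [pair_edge] settles the pair
    itself. *)
Lemma pair_iso :
  exists2 s : T -> T, bijective s & forall a b, e' (s a) (s b) = e a b.
Proof.
have offP w : [\/ w = u, w = v | off w].
  rewrite /off; case: eqP => [->|_]; first by constructor 1.
  by case: eqP => [->|_]; [constructor 2 | constructor 3].
have [rows | rows] := pair_rows.
  exists id; first by exists id.
  move=> a b; have [->|->|oa] := offP a; have [->|->|ob] := offP b;
    rewrite ?e_irr ?e'_irr ?pair_edge // ?(e_sym v u) ?(e'_sym v u) ?pair_edge //.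
  - by rewrite e_sym e'_sym; have [] := rows b ob.
  - by rewrite e_sym e'_sym; have [] := rows b ob.
  - by have [] := rows a oa.
  - by have [] := rows a oa.
  exact: agree.
pose s w := if w == u then v else if w == v then u else w.
have su : s u = v by rewrite /s eqxx.
have sv : s v = u by rewrite /s eqxx eq_sym (negPf uv).
have so w : off w -> s w = w by rewrite /s => /andP[/negPf-> /negPf->].
have sK : involutive s.
  by move=> w; have [->|->|/[dup]ow/so sw] := offP w; rewrite ?su ?sv // !sw.
exists s; first by exists s.
move=> a b; have [->|->|oa] := offP a; have [->|->|ob] := offP b;
  rewrite ?su ?sv ?(so a) ?(so b) // ?e_irr ?e'_irr //
    ?(e_sym v u) ?(e'_sym v u) ?pair_edge //.
- by rewrite e_sym e'_sym; have [] := rows b ob.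
- by rewrite e_sym e'_sym; have [] := rows b ob.
- by have [] := rows a oa.
- by have [] := rows a oa.
exact: agree.
Qed.

End AgreeOffPair.

(** * Placing two graphs on one vertex set through a common card *)

Lemma induced_iso_extend (G H : sgraph) (u v : H) (x y : G) :
  #|H| = #|G| -> u != v -> x != y ->
  isomorphic (induced (~: [set u; v])) (induced (~: [set x; y])) ->
  exists h : H -> G, [/\ bijective h, h u = x, h v = y &
    forall a b, (a != u) && (a != v) -> (b != u) && (b != v) ->
      adj (h a) (h b) = adj a b].
Proof.
move=> HG uv xy [f fB fE].
(* [insub] fails only at [u] and [v]. *)
pose h w := if insub w is Some w' then val (f w') else if w == u then x else y.
have hu : h u = x by rewrite /h insubF ?eqxx // !inE eqxx.
have hv : h v = y.
  by rewrite /h insubF ?[v == u]eq_sym ?(negPf uv) // !inE eqxx orbT.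
have offE w : (w != u) && (w != v) -> w \in ~: [set u; v] by rewrite !inE negb_or.
have ho w (ow : w \in ~: [set u; v]) : h w = val (f (Sub w ow)).
  by rewrite /h insubT.
have offP w : [\/ w = u, w = v | w \in ~: [set u; v]].
  rewrite !inE; case: eqP => [->|_]; first by constructor 1.
  by case: eqP => [->|_]; [constructor 2 | constructor 3].
have hne w : w \in ~: [set u; v] -> (h w != x) * (h w != y).
  move=> ow; rewrite ho; have := valP (f (Sub w ow)).
  by rewrite !inE negb_or => /andP[].
exists h; split=> //; last first.
  by move=> a b /offE oa /offE ob; rewrite !ho; apply: fE.
apply: inj_card_bij; last by rewrite HG.
move=> a b; have [->|->|oa] := offP a; have [->|->|ob] := offP b => //;
  rewrite ?hu ?hv => /eqP; rewrite ?[x == h _]eq_sym ?[y == h _]eq_sym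
    ?[y == x]eq_sym ?(negPf xy) ?(negPf (hne _ _).1) ?(negPf (hne _ _).2) //.
by rewrite !ho => /eqP/val_inj/(bij_inj fB)/(congr1 val).
Qed.

(** The card of [H] missing [u] and [v] also occurs in the deck of [G], where a matching card misses
    some [x] and [y]. *)
Lemma same_deck_card (G H : sgraph) (u v : H) :
  2 <= #|G| -> #|H| = #|G| -> same_deck (#|G| - 2) G H -> u != v ->
  exists2 h : H -> G, bijective h &
    forall a b, (a != u) && (a != v) -> (b != u) && (b != v) ->
      adj (h a) (h b) = adj a b.
Proof.
move=> G2 HG deck uv.
have : 0 < deck_mult (#|G| - 2) G (induced (~: [set u; v])).
  rewrite deck; apply/card_gt0P; exists (~: [set u; v]); rewrite inE.
  rewrite [#|~: _|]cardsCs setCK cards2 uv HG eqxx.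
  exact/isomorphicP/isomorphic_refl.
case/card_gt0P=> A; rewrite inE => /andP[/eqP Am /isomorphicP AB].
have /cards2P[x [y [xy Axy]]] : #|~: A| == 2.
  by apply/eqP; rewrite cardsCs setCK Am subKn.
move: AB; rewrite -[A]setCK Axy => /isomorphic_sym /(induced_iso_extend HG uv xy).
by case=> h [hB _ _ hE]; exists h.
Qed.

Theorem theorem2 (G : sgraph) (k lambda mu : nat) :
  strongly_regular G k lambda mu -> 6 <= #|G| -> reconstructible 2 G.
Proof.
case=> regG lamG muG G6 H HG deck.
have regH := same_deck_regular (ltnW G6) HG deck regG.
have G2 : 2 <= #|G| by lia.
have adj_neq (K : sgraph) (a b : K) : adj a b -> a != b.
  by apply: contraTneq => ->; rewrite adj_irrefl.
have degE (h : H -> G) : bijective h -> forall w : H,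
    \sum_b (adj w b : nat) = \sum_b (adj (h w) (h b) : nat).
  move=> hB w; rewrite -card_set_sum regH -(regG (h w)) card_set_sum.
  by rewrite (reindex h) //; apply: onW_bij.
have codegE (h : H -> G) : bijective h -> forall w z : H,
    \sum_b (adj (h w) (h b) && adj (h z) (h b) : nat) = #|common_nbrs (h w) (h z)|.
  by move=> hB w z; rewrite card_set_sum [RHS](reindex h) //; apply: onW_bij.
have [lamH muH] :
    (forall u v : H, adj u v -> #|common_nbrs u v| = lambda) /\
    (forall u v : H, u != v -> ~~ adj u v -> #|common_nbrs u v| = mu).
  (* Each pair has its own bijection [h], along which [G] is pulled back to [H]. *)
  have transfer (u v : H) : u != v -> exists x y : G,
      [/\ x != y, adj u v = adj x y & #|common_nbrs u v| = #|common_nbrs x y|].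
    move=> uv; have [h hB hE] := same_deck_card G2 HG deck uv.
    pose e' : rel H := fun a b => adj (h a) (h b).
    have e'_sym : symmetric e' by move=> a b; apply: adj_sym.
    have e'_irr : irreflexive e' by move=> a; apply: adj_irrefl.
    exists (h u), (h v); split; first by rewrite (bij_eq hB).
      exact: (pair_edge (@adj_sym H) e'_sym (@adj_irrefl H) e'_irr uv hE (degE h hB)).
    rewrite card_set_sum -codegE //.
    exact: (pair_codegree (@adj_sym H) e'_sym (@adj_irrefl H) e'_irr uv hE (degE h hB)).
  split=> u v uv => [|nuv].
    have [x [y [_ xy ->]]] := transfer u v (adj_neq _ _ _ uv).
    by apply: lamG; rewrite -xy.
  have [x [y [nxy xy ->]]] := transfer u v uv.
  by apply: muG; rewrite // -xy.
have [u [v uv]] : exists u v : H, u != v.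
  by have /card_gt1P[u [v [_ _ uv]]] : 1 < #|H|; [rewrite HG | exists u, v].
have [h hB hE] := same_deck_card G2 HG deck uv.
pose e' : rel H := fun a b => adj (h a) (h b).
have e'_sym : symmetric e' by move=> a b; apply: adj_sym.
have e'_irr : irreflexive e' by move=> a; apply: adj_irrefl.
(* Off the pair, adjacency is the same in both graphs, so the shared parameters give equal
   codegrees. *)
have codeg_eq (w z : H) : (w != u) && (w != v) -> (z != u) && (z != v) -> w != z ->
    \sum_b (adj w b && adj z b : nat) = \sum_b (e' w b && e' z b : nat).
  move=> ow oz wz; rewrite codegE // -card_set_sum.
  have hwz : h w != h z by rewrite (bij_eq hB).
  have [awz | nwz] := boolP (adj w z).
    by rewrite [LHS]lamH // lamG // hE.
  by rewrite [LHS]muH // muG // hE.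
have [s sB sE] := pair_iso (@adj_sym H) e'_sym (@adj_irrefl H) e'_irr uv hE
  (degE h hB) codeg_eq.
by exists (h \o s) => //; apply: bij_comp.
Qed.
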